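(* Let $\nu$ be a magnetic potential on $\Gamma_n$ and let $\mathfrak{C}=\{C_j \mid 0\le j\le n\}$ be a coin operator system on $\mathcal{K}$. Let $\mathsf{W}^{(\nu)}=\sum_{j=0}^n \Xi_j^{(\nu)}\otimes C_j$ on $\mathfrak{h}_n\otimes\mathcal{K}$ and $U_\sigma=\sum_{j=0}^n\mathcal{E}_\sigma(j)C_j$ on $\mathcal{K}$ for $\sigma\in\Gamma_n$. Then $$\mathrm{Aev}(\mathsf{W}^{(\nu)})=\bigcup_{\sigma\in\Gamma_n}\mathrm{Aev}(U_\sigma),$$ where $\mathrm{Aev}(T)$ denotes the approximate-spectrum (the set of all approximate eigenvalues) of a bounded operator $T$.
   Context: Fix an integer $n\ge 0$. $\mathbb{N}_n=\{0,1,\dots,n\}$ and $\Gamma_n$ is the power set of $\mathbb{N}_n$. $\mathfrak{h}_n$ is the complex Hilbert space of dimension $2^{n+1}$ with orthonormal basis $\{Z_\sigma\mid\sigma\in\Gamma_n\}$. For $j\in\mathbb{N}_n$, the operators $\partial_j$ and $\partial_j^*$ on $\mathfrak{h}_n$ are the (mutually adjoint) linear operators determined by $\partial_jZ_\sigma=\mathbf{1}_\sigma(j)Z_{\sigma\setminus\{j\}}$ and $\partial_j^*Z_\sigma=(1-\mathbf{1}_\sigma(j))Z_{\sigma\cup\{j\}}$, where $\mathbf{1}_\sigma$ is the indicator function of $\sigma$. A magnetic potential on $\Gamma_n$ is a function $\nu:\Gamma_n\times\Gamma_n\to[-\pi,\pi]$ with $\nu(\sigma,\tau)=-\nu(\tau,\sigma)$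 for all $\sigma,\tau\in\Gamma_n$. Put $\nu_j=\nu(\{j\},\mathbb{N}_n\setminus\{j\})$ for $j\in\mathbb{N}_n$, and $\Xi_j^{(\nu)}=e^{-\mathrm{i}\nu_j}\partial_j^*+e^{\mathrm{i}\nu_j}\partial_j$, an operator on $\mathfrak{h}_n$. $\mathcal{K}$ is a complex separable Hilbert space (possibly infinite-dimensional) with $\dim\mathcal{K}\ge n+1$. A coin operator system on $\mathcal{K}$ is a family $\{C_j\mid 0\le j\le n\}$ of bounded linear operators on $\mathcal{K}$ such that $\sum_{j=0}^nC_j$ is unitary and $C_j^*C_k=C_jC_k^*=0$ for all $j\ne k$, $0\le j,k\le n$. For $\sigma\in\Gamma_n$ and $j\in\mathbb{N}_n$, $\mathcal{E}_\sigma(j)=2\cdot\mathbf{1}_\sigma(j)-1$, i.e. $1$ if $j\in\sigma$ and $-1$ otherwise. For a bounded operator $T$ on a complex Hilbert space $\mathcal{H}$, a complex number $\lambda$ is an approximate eigenvalue of $T$ if there is a sequence $(x_k)_{k\ge1}$ of unit vectors in $\mathcal{H}$ with $\|Tx_k-\lambda x_k\|\to0$ as $k\to\infty$. *)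

(* Defs.v *)
From HB Require Import structures.
From mathcomp Require Import all_boot all_order all_algebra ring lra.
From mathcomp Require Import sesquilinear complex.
From mathcomp Require Import all_classical all_reals all_analysis.

Set Implicit Arguments.
Unset Strict Implicit.
Unset Printing Implicit Defensive.

Import Order.TTheory GRing.Theory Num.Theory Num.Def.
Import numFieldNormedType.Exports.

Local Open Scope classical_set_scope.
Local Open Scope ring_scope.

Section DotNorm.
Variables (C : numClosedFieldType) (U : lmodType C) (f : {dot U for conjC}).

Lemma dot_ge0 u : 0 <= f u u.
Proof.
have [->|uN0] := eqVneq u 0; first by rewrite linear0l.
exact/ltW/neq0_dnorm_gt0.
Qed.

Lemma dot_conj u v : (f u v)^* = f v u.
Proof. by rewrite (hermitian_subproof v u) mul1r. Qed.

Lemma dot_norm_eq0 u : sqrtC (f u u) = 0 -> u = 0.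
Proof.
move/eqP; rewrite sqrtC_eq0; apply: contraTeq => /neq0_dnorm_gt0 h.
exact: lt0r_neq0.
Qed.

Lemma dot_normZ a u : sqrtC (f (a *: u) (a *: u)) = `|a| * sqrtC (f u u).
Proof.
rewrite linearZl_LR linearZr_LR/= mulrA -normCK.
by rewrite sqrtCM ?nnegrE ?exprn_ge0 ?dot_ge0// sqrCK.
Qed.

Lemma dot_CS u v : `|f u v| <= sqrtC (f u u) * sqrtC (f v v).
Proof.
rewrite -ler_sqr ?nnegrE ?mulr_ge0 ?sqrtC_ge0 ?dot_ge0// exprMn !sqrtCK.
have [->|vN0] := eqVneq v 0.
  by rewrite !linear0r normr0 expr0n/= ?mulr0.
have v0 : 0 < f v v by exact: neq0_dnorm_gt0.
have nf : `|f u v| ^+ 2 = f u v * f v u by rewrite normCK dot_conj.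
have := dot_ge0 (f v v *: u - f u v *: v).
rewrite !(linearBl, linearBr)/= !(linearZl_LR, linearZr_LR)/=.
rewrite (geC0_conj (ltW v0)) dot_conj.
rewrite [leRHS](_ : _ = f v v * (f u u * f v v - `|f u v| ^+ 2)).
  by rewrite pmulr_rge0// subr_ge0.
by rewrite nf /GRing.scale/=; ring.
Qed.

Lemma dot_triangle u v :
  sqrtC (f (u + v) (u + v)) <= sqrtC (f u u) + sqrtC (f v v).
Proof.
rewrite -ler_sqr ?nnegrE ?addr_ge0 ?sqrtC_ge0 ?dot_ge0// sqrrD !sqrtCK.
rewrite !(linearDl, linearDr)/= -/(GRing.add _ _).
rewrite [leLHS](_ : _ = f u u + (f u v + f v u) + f v v); last first.
  by rewrite !addrA.
rewrite lerD2r lerD2l.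
have cR : f u v + f v u \is Num.real.
  by rewrite CrealE rmorphD/= !dot_conj addrC.
rewrite (le_trans (real_ler_norm cR))// (le_trans (ler_normD _ _))//.
rewrite mulr2n lerD// ?dot_CS//.
by rewrite mulrC dot_CS.
Qed.

End DotNorm.

(* [inner] is linear in its first argument, conjugate-linear in the second. *)
HB.mixin Record isHilbert (R : realType) H of CompleteNormedModule R[i] H := {
  inner : {dot H for conjC} ;
  norm_inner : forall x : H, `|x| = sqrtC (inner x x)
}.

#[short(type="hilbertType")]
HB.structure Definition Hilbert (R : realType) :=
  {H of CompleteNormedModule R[i] H & isHilbert R H}.

Section ComplexHilbert.
Variable R : realType.

Lemma complex_norm_lt (z : R[i]) (e : R) :
  `|complex.Re z| < e / 2 -> `|complex.Im z| < e / 2 -> `|z| < e%:C%C.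
Proof.
case: z => a b /= ha hb.
have -> : (a +i* b)%C = a%:C%C + 'i%C * b%:C%C by rewrite [LHS]complexE.
apply: le_lt_trans (ler_normD _ _) _.
rewrite normrM !normc_def/= !expr0n/= !addr0 !add0r expr1n sqrtr1 mul1r.
by rewrite !sqrtr_sqr -rmorphD/= ltcR [ltRHS]splitr ltrD.
Qed.

Lemma complex_complete (F : set_system R[i]^o) :
  ProperFilter F -> cauchy F -> cvg F.
Proof.
move=> FF /cauchy_ballP Fc; apply/cvg_ex.
have cpart (p : R[i] -> R) : {morph p : x y / x - y} ->
    (forall z, (`|p z|)%:C%C <= `|z|) -> cvg (p @ F).
  move=> pB ple; apply: R_complete; apply/cauchy_ballP => e e0.
  have e0' : 0 < e%:C%C :> R[i] by rewrite ltcR.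
  rewrite near_map2; have := Fc _ e0'; apply: filterS => -[x y] /=.
  rewrite -!ball_normE/= => h.
  by rewrite -pB -ltcR; exact: le_lt_trans (ple _) h.
have cRe : cvg ((@complex.Re R) @ F).
  by apply: cpart => [[? ?] [? ?]//|z]; exact: normc_ge_Re.
have cIm : cvg ((@complex.Im R) @ F).
  apply: cpart => [[? ?] [? ?]//|[a b]].
  by rewrite normc_def lecR -sqrtr_sqr ler_sqrt/= ?lerDr ?addr_ge0 ?sqr_ge0.
exists (Complex (lim ((@complex.Re R) @ F)) (lim ((@complex.Im R) @ F))).
apply/cvgrPdist_lt => e; case: e => e e' /[dup] e0.
rewrite ltcE/= => /andP[/eqP ee]; rewrite ee in e0 *; move=> {}e0.
have e20 : 0 < e / 2 by rewrite divr_gt0.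
move/cvgrPdist_lt : cRe => /(_ _ e20); move/cvgrPdist_lt : cIm => /(_ _ e20).
apply: filterS2 => -[a b]/= hb ha.
exact: complex_norm_lt.
Qed.

(* A copy of [R[i]^o]: [mathcomp-analysis] already keys a completeness
   instance for real scalars on [_^o]. *)
Definition cscalar (T : realType) : Type := T[i].
HB.instance Definition _ := NormedModule.copy (cscalar R) R[i]^o.
HB.instance Definition _ := Uniform_isComplete.Build (cscalar R) complex_complete.

Definition cinner (x y : (cscalar R)) : R[i] := x * (y^*).

Lemma cinner_bilinear : bilinear_for
  (GRing.Scale.Law.clone _ _ *%R _)
  (GRing.Scale.Law.clone _ _ (conjC \; *%R) _) cinner.
Proof.
split=> [y|x] a u v; rewrite /cinner /=.
  by rewrite mulrDl mulrA.
by rewrite rmorphD rmorphM mulrDr mulrCA.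
Qed.

HB.instance Definition _ :=
  bilinear_isBilinear.Build R[i] (cscalar R) (cscalar R) R[i] _ _ cinner cinner_bilinear.

Lemma cinner_herm x y : cinner x y = (-1) ^+ false * (cinner y x)^*.
Proof. by rewrite /cinner mul1r rmorphM/= Num.Theory.conjCK mulrC. Qed.

HB.instance Definition _ :=
  isHermitianSesquilinear.Build R[i] (cscalar R) false conjC cinner cinner_herm.

Lemma cinner_gt0 (x : (cscalar R)) : x != 0 -> 0 < cinner x x.
Proof. by move=> x0; rewrite /cinner -normCK exprn_gt0 ?normr_gt0. Qed.

HB.instance Definition _ := isDotProduct.Build R[i] (cscalar R) cinner cinner_gt0.

Lemma norm_cinner (x : (cscalar R)) : `|x| = sqrtC (cinner x x).
Proof. by rewrite /cinner -normCK sqrCK. Qed.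

HB.instance Definition _ := isHilbert.Build R (cscalar R) norm_cinner.

End ComplexHilbert.

Section HilbertSum.
Variables (R : realType) (I : finType) (H : hilbertType R).

Definition hsum : Type := {ffun I -> H}.
HB.instance Definition _ := GRing.Lmodule.copy hsum {ffun I -> H}.

Definition hsum_inner (f g : hsum) : R[i] :=
  \sum_i inner ((f : {ffun I -> H}) i) ((g : {ffun I -> H}) i).

Lemma hsum_inner_bilinear : bilinear_for
  (GRing.Scale.Law.clone _ _ *%R _)
  (GRing.Scale.Law.clone _ _ (conjC \; *%R) _) hsum_inner.
Proof.
split=> [y|x] a u v; rewrite /hsum_inner /= mulr_sumr -big_split/=.
  by apply: eq_bigr => i _; rewrite !ffunE linearDl linearZl_LR.
by apply: eq_bigr => i _; rewrite !ffunE linearDr linearZr_LR.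
Qed.

HB.instance Definition _ := bilinear_isBilinear.Build
  R[i] hsum hsum R[i] _ _ hsum_inner hsum_inner_bilinear.

Lemma hsum_inner_herm x y : hsum_inner x y = (-1) ^+ false * (hsum_inner y x)^*.
Proof.
rewrite mul1r /hsum_inner rmorph_sum/=.
by apply: eq_bigr => i _; rewrite dot_conj.
Qed.

HB.instance Definition _ := isHermitianSesquilinear.Build
  R[i] hsum false conjC hsum_inner hsum_inner_herm.

Lemma hsum_inner_gt0 (x : hsum) : x != 0 -> 0 < hsum_inner x x.
Proof.
move=> x0; rewrite lt_def sumr_ge0 ?andbT; last by move=> i _; exact: dot_ge0.
apply: contra_neq x0 => /eqP.
rewrite psumr_eq0 => [/allP h|i _]; last exact: dot_ge0.
apply/ffunP => i; rewrite ffunE; apply: (@dot_norm_eq0 _ _ inner).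
by have /eqP -> := h i (mem_index_enum _); rewrite sqrtC0.
Qed.

HB.instance Definition _ := isDotProduct.Build R[i] hsum hsum_inner hsum_inner_gt0.

Definition hsum_norm (f : hsum) : R[i] := sqrtC (hsum_inner f f).

HB.instance Definition _ := Lmodule_isNormed.Build R[i] hsum
  (dot_triangle hsum_inner) (dot_normZ hsum_inner) (@dot_norm_eq0 _ _ hsum_inner).

Lemma norm_hsum (f : hsum) : `|f| = sqrtC (hsum_inner f f).
Proof. by []. Qed.

Lemma le_norm_hsum (f : hsum) i : `|(f : {ffun I -> H}) i| <= `|f|.
Proof.
rewrite norm_hsum norm_inner ler_sqrtC ?nnegrE ?dot_ge0 ?hsum_inner_ge0//.
rewrite /hsum_inner (bigD1 i)//= lerDl sumr_ge0// => j _; exact: dot_ge0.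
Qed.

Lemma norm_hsum_le (f : hsum) : `|f| <= \sum_i `|(f : {ffun I -> H}) i|.
Proof.
rewrite norm_hsum -ler_sqr ?nnegrE ?sqrtC_ge0 ?dot_ge0 ?sumr_ge0// sqrtCK.
rewrite expr2 mulr_sumr ler_sum// => i _.
rewrite -[inner _ _]sqrtCK -norm_inner expr2 ler_wpM2r//.
by rewrite (bigD1 i)//= lerDl sumr_ge0.
Qed.

Lemma hsum_complete (F : set_system hsum) :
  ProperFilter F -> cauchy F -> cvg F.
Proof.
move=> FF /cauchy_ballP Fc; apply/cvg_ex.
have cF i : cvg ((fun f : hsum => (f : {ffun I -> H}) i) @ F).
  apply: cauchy_cvg; apply/cauchy_ballP => e e0.
  rewrite near_map2; have := Fc _ e0; apply: filterS => -[x y] /=.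
  rewrite -!ball_normE/=; apply: le_lt_trans.
  by have := le_norm_hsum (x - y) i; rewrite !ffunE.
exists ([ffun i => lim ((fun f : hsum => (f : {ffun I -> H}) i) @ F)] : {ffun I -> H}).
apply/cvgrPdist_le => e e0.
have d0 : 0 < e / #|I|.+1%:R by rewrite divr_gt0.
have : \forall f \near F, forall i, i \in enum I ->
    `|lim ((fun f : hsum => (f : {ffun I -> H}) i) @ F) -
      (f : {ffun I -> H}) i| <= e / #|I|.+1%:R.
  elim: (enum I) => [|i s IH]; first by near=> f.
  move/cvgrPdist_le : (cF i) => /(_ _ d0).
  move: IH; apply: filterS2 => f fs fi j.
  by rewrite inE => /predU1P[->//|/fs].
apply: filterS => f fI; apply: le_trans (norm_hsum_le _) _.
apply: (@le_trans _ _ (\sum_(i in I) e / #|I|.+1%:R)).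
  by apply: ler_sum => i _; rewrite !ffunE; apply: fI; rewrite mem_enum.
rewrite sumr_const -mulrnAr ger_pMr// -[_ *+ _]mulr_natl.
by rewrite ler_pdivrMr ?ltr0n// mul1r ler_nat.
Unshelve. all: by end_near. Qed.

HB.instance Definition _ := Uniform_isComplete.Build hsum hsum_complete.
HB.instance Definition _ := isHilbert.Build R hsum norm_hsum.

End HilbertSum.

Definition bounded_op (R : realType) (H H' : hilbertType R) (T : H -> H') :=
  exists M : R, forall x, `|T x| <= M%:C%C * `|x|.

(* The default value 0 is never used for bounded linear T: see [adjointP]. *)
Definition adjoint (R : realType) (H : hilbertType R)
    (T : H -> H) (y : H) : H :=
  xget 0 [set z | forall x, inner (T x) y = inner x z].

Section Riesz.
Variables (R : realType) (H : hilbertType R).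
Implicit Types x y z : H.

Let hn x : R := complex.Re `|x|.

Let hnE x : `|x| = (hn x)%:C%C.
Proof. by rewrite /hn RRe_real// ger0_real. Qed.

Let hn_ge0 x : 0 <= hn x.
Proof. by rewrite -ler0c -hnE. Qed.

Lemma inner_sqr x : inner x x = `|x| ^+ 2.
Proof. by rewrite norm_inner sqrtCK. Qed.

Lemma parallelogram x y :
  `|x + y| ^+ 2 + `|x - y| ^+ 2 = (`|x| ^+ 2 + `|y| ^+ 2) *+ 2.
Proof.
by rewrite -!inner_sqr !(linearDl, linearDr)/= !(linearNl, linearNr)/=; ring.
Qed.

Let hn_parallelogram x y :
  hn (x + y) ^+ 2 + hn (x - y) ^+ 2 = (hn x ^+ 2 + hn y ^+ 2) *+ 2.
Proof.
apply: complexI; rewrite rmorphMn/= !rmorphD/= !rmorphXn/= -!hnE.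
exact: parallelogram.
Qed.

Let min_ortho x y : (forall t : R[i], `|x| <= `|x + t *: y|) -> inner y x = 0.
Proof.
move=> xmin; have [->|yN0] := eqVneq y 0; first by rewrite linear0l.
have y0 : 0 < inner y y by exact: neq0_dnorm_gt0.
have nf : `|inner y x| ^+ 2 = inner y x * inner x y by rewrite normCK dot_conj.
have := xmin (- (inner x y / inner y y)).
rewrite -ler_sqr ?nnegrE// -!inner_sqr.
rewrite !(linearDl, linearDr)/= !(linearZl_LR, linearZr_LR)/=.
rewrite rmorphN rmorphM/= fmorphV/= !dot_conj.
rewrite [leRHS](_ : _ = inner x x - `|inner y x| ^+ 2 / inner y y); last first.
  by rewrite nf /GRing.scale/=; field; exact: lt0r_neq0.
rewrite lerBrDr gerDl pmulr_lle0 ?invr_gt0// => h.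
have : `|inner y x| ^+ 2 == 0 by rewrite eq_le h exprn_ge0.
by rewrite expf_eq0/= normr_eq0 => /eqP.
Qed.

Let min_estimate (a b s t d e : R) : 0 <= d -> 0 < e -> e <= 1 ->
  0 <= a -> 0 <= b -> 0 <= s -> a < d + e -> b < d + e -> d <= 2^-1 * s ->
  s ^+ 2 + t ^+ 2 = (a ^+ 2 + b ^+ 2) *+ 2 ->
  t ^+ 2 <= 4 * e * (d *+ 2 + 1).
Proof.
move=> d0 e0 e1 a0 b0 s0 ade bde ds.
have ha : a ^+ 2 <= (d + e) ^+ 2 by rewrite ler_sqr ?nnegrE ?addr_ge0 ?(ltW e0)// ltW.
have hb : b ^+ 2 <= (d + e) ^+ 2 by rewrite ler_sqr ?nnegrE ?addr_ge0 ?(ltW e0)// ltW.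
have hs : (2 * d) ^+ 2 <= s ^+ 2.
  by rewrite ler_sqr ?nnegrE ?mulr_ge0// -ler_pdivlMl.
have he : e ^+ 2 <= e by rewrite expr2 ger_pMr.
rewrite !mulr2n; lra.
Qed.

Lemma riesz (f : {scalar H}) (M : R) :
  (forall x, `|f x| <= M%:C%C * `|x|) -> exists z, forall x, f x = inner x z.
Proof.
move=> fM; have [f0|] := pselect (forall x, f x = 0).
  by exists 0 => x; rewrite f0 linear0r.
move=> /existsNP[x1 /eqP fx1].
pose A := [set x | f x = 1].
pose D := [set r | exists2 x, A x & r = hn x].
have Ax : A ((f x1)^-1 *: x1) by rewrite /A/= linearZ/= mulVf.
have D0 : has_inf D.
  by split; [exists (hn ((f x1)^-1 *: x1)); exists ((f x1)^-1 *: x1)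
            |exists 0 => _ [x _ ->]].
pose d := inf D.
have dle x : A x -> d <= hn x.
  by move=> ?; apply: (ge_inf D0.2); exists x.
have d0 : 0 <= d by apply: lb_le_inf; [exact: D0.1|move=> _ [x _ ->]].
have /choice[u uP] (n : nat) : exists x, A x /\ hn x < d + n.+1%:R^-1.
  have /(inf_adherent)/(_ D0)[_ [x ? ->] ?] : 0 < n.+1%:R^-1 :> R.
    by rewrite invr_gt0.
  by exists x.
have duv x y (e : R) : 0 < e <= 1 -> A x -> A y -> hn x < d + e ->
    hn y < d + e -> hn (x - y) ^+ 2 <= 4 * e * (d *+ 2 + 1).
  move=> /andP[e0 e1] xA yA xe ye.
  have /dle : A (2^-1 *: (x + y)).
    by rewrite /A/= linearZ linearD/= xA yA mulVf// pnatr_eq0.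
  have -> : hn (2^-1 *: (x + y)) = 2^-1 * hn (x + y).
    apply: complexI; rewrite -hnE normrZ hnE rmorphM/= fmorphV rmorph_nat.
    by rewrite ger0_norm.
  move=> dxy; have := hn_parallelogram x y.
  have := hn_ge0 x; have := hn_ge0 y; have := hn_ge0 (x + y).
  by move=> *; apply: (@min_estimate (hn x) (hn y) (hn (x + y))).
have inv1 (n : nat) : 0 < (n.+1%:R^-1 : R) <= 1.
  by rewrite invr_gt0 ltr0n/= invf_le1// ler1n.
have : cauchy (u @ \oo).
  apply: cauchy_exP => e; case: e => e e' /[dup] e0.
  rewrite ltcE/= => /andP[/eqP ee]; rewrite ee in e0 *; move=> {}e0.
  have c0 : 0 < e ^+ 2 / (4 * (d *+ 2 + 1)).
    by rewrite divr_gt0 ?exprn_gt0// mulr_gt0// ltr_wpDl// mulrn_wge0.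
  have [N _ NP] := near_infty_natSinv_lt (PosNum c0).
  exists (u N); exists N => // m /= Nm.
  rewrite -ball_normE/= hnE ltcR -ltr_sqr ?nnegrE ?(ltW e0)//.
  have h := duv (u N) (u m) N.+1%:R^-1 (inv1 N) (uP N).1 (uP m).1 (uP N).2.
  apply: le_lt_trans (h _) _.
    apply: lt_le_trans (uP m).2 _.
    by rewrite lerD2l lef_pV2 ?posrE ?ltr0n// ler_nat.
  have := NP N (leqnn N); rewrite /= ltr_pdivlMr.
    by rewrite mulrCA mulrA.
  by rewrite mulr_gt0// ltr_wpDl// mulrn_wge0.
move=> /cauchy_cvg/cvg_ex[x ux].
have hux (e : R) : 0 < e -> \forall n \near \oo, hn (x - u n) < e.
  move=> e0; have e0' : 0 < e%:C%C :> R[i] by rewrite ltcR.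
  move/cvgrPdist_lt : ux => /(_ _ e0').
  by apply: filterS => n; rewrite hnE ltcR.
have M1 : 0 < `|M| + 1 by rewrite ltr_wpDl.
have fx : A x.
  apply/eqP; rewrite -subr_eq0 -normr_eq0 eq_le normr_ge0 andbT.
  have [r rE] : exists r : R, `|f x - 1| = r%:C%C.
    by exists (complex.Re `|f x - 1|); rewrite RRe_real// ger0_real.
  rewrite rE.
  rewrite -[0]/(0%:C%C) lecR; apply/ler_addgt0Pr => e e0; rewrite add0r.
  have [|N _ /(_ N (leqnn N)) /= NP] := hux (e / (`|M| + 1)).
    by rewrite divr_gt0.
  rewrite -lecR -rE -(uP N).1 -linearB/=.
  apply: le_trans (fM _) _; rewrite hnE -rmorphM/= lecR.
  apply: (@le_trans _ _ ((`|M| + 1) * hn (x - u N))).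
    by rewrite ler_wpM2r// (le_trans (ler_norm _))// lerDl.
  by rewrite mulrC -ler_pdivlMr// ltW.
have xd : hn x <= d.
  apply/ler_addgt0Pr => e e0; have e20 : 0 < e / 2 by rewrite divr_gt0.
  have [N1 _ N1P] := hux _ e20.
  have [N2 _ N2P] := near_infty_natSinv_lt (PosNum e20).
  pose n := maxn N1 N2.
  have h1 : hn (x - u n) < e / 2 := N1P n (leq_maxl _ _).
  have h2 : n.+1%:R^-1 < e / 2 := N2P n (leq_maxr _ _).
  have h3 := (uP n).2.
  have : hn x <= hn (x - u n) + hn (u n).
    by rewrite -lecR rmorphD/= -!hnE (le_trans _ (ler_normD _ _))// subrK.
  move: h1 h2 h3; move: (n.+1%:R^-1) (hn x) (hn (x - _)) (hn (u n)) => *; lra.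
have xker y : f y = 0 -> inner y x = 0.
  move=> fy; apply: min_ortho => t; rewrite !hnE lecR (le_trans xd)// dle//.
  by rewrite /A/= linearD linearZ/= fy mulr0 addr0.
have xx0 : inner x x != 0.
  rewrite lt0r_neq0// neq0_dnorm_gt0//; apply/eqP => x0.
  by move: fx; rewrite /A/= x0 linear0 => /esym/eqP; rewrite oner_eq0.
exists ((inner x x)^-1 *: x) => y.
have /xker : f (y - f y *: x) = 0.
  by rewrite linearB linearZ/= fx mulr1 subrr.
rewrite linearBl/= linearZl_LR/= => /eqP; rewrite subr_eq0 => /eqP h.
rewrite linearZr_LR/= h fmorphV/= dot_conj /GRing.scale/=.
by rewrite mulrCA mulVf// mulr1.
Qed.

Lemma adjointP (T : {linear H -> H}) : bounded_op T ->
  forall x y, inner (T x) y = inner x (adjoint T y).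
Proof.
move=> [M TM] x y; rewrite /adjoint; case: xgetP => [z _ -> //|nz].
pose f x : R[i]^o := inner (T x) y.
have fl : linear f.
  by move=> a u v; rewrite /f linearP linearDl linearZl_LR.
pose fL := GRing.isLinear.Build _ _ _ _ f fl.
pose F : {scalar H} := HB.pack f fL.
have [|z zP] := @riesz F (M * hn y).
  move=> v; rewrite rmorphM/= -hnE mulrAC.
  have := dot_CS inner (T v) y; rewrite -!norm_inner => h.
  by apply: le_trans h _; rewrite ler_wpM2r.
by have := nz z; case.
Qed.

End Riesz.

Definition hsum_fun (R : realType) (I : finType) (H : hilbertType R)
  (f : hsum I H) : I -> H := f : {ffun I -> H}.
Coercion hsum_fun : hsum >-> Funclass.

Section HsumFun.
Variables (R : realType) (I : finType) (H : hilbertType R).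
Implicit Types f g : hsum I H.

Lemma hsumP f g : (forall i, f i = g i) -> f = g.
Proof. by move=> fg; apply/ffunP. Qed.

Lemma hsumE (F : I -> H) i : hsum_fun [ffun j => F j] i = F i.
Proof. by rewrite /hsum_fun ffunE. Qed.

Lemma hsum_addE f g i : hsum_fun (f + g) i = f i + g i.
Proof. by rewrite /hsum_fun ffunE. Qed.

Lemma hsum_scaleE (a : R[i]) f i : hsum_fun (a *: f) i = a *: f i.
Proof. by rewrite /hsum_fun ffunE. Qed.

Lemma hsum_sumE (J : Type) (r : seq J) (P : pred J) (F : J -> hsum I H) i :
  hsum_fun (\sum_(j <- r | P j) F j) i = \sum_(j <- r | P j) F j i.
Proof.
elim/big_rec2: _ => [|j x y _ <-]; last by rewrite hsum_addE.
by rewrite /hsum_fun ffunE.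
Qed.

End HsumFun.

Definition separable (R : realType) (H : hilbertType R) :=
  exists D : set H, countable D /\ dense D.

(* m <= dim H: H contains m linearly independent vectors. *)
Definition dim_ge (R : realType) (H : hilbertType R) (m : nat) :=
  exists v : 'I_m -> H, forall c : 'I_m -> R[i],
    \sum_i c i *: v i = 0 -> forall i, c i = 0.

Definition unitary (R : realType) (H : hilbertType R) (T : H -> H) :=
  (forall x, adjoint T (T x) = x) /\ (forall x, T (adjoint T x) = x).

Definition Aev (R : realType) (H : hilbertType R) (T : H -> H) : set R[i] :=
  [set lambda | exists x : nat -> H, (forall k, `|x k| = 1) /\
    ((`|T (x k) - lambda *: x k| : R[i]^o) @[k --> \oo] --> (0 : R[i]^o))].

Section Tensor.
Variables (R : realType) (I : finType) (K : hilbertType R).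

(* The Hilbert space C^I, with its orthonormal basis. *)
Local Notation cspace := (hsum I (cscalar R)).

Definition cbasis (i : I) : cspace :=
  ([ffun k => (k == i)%:R] : {ffun I -> cscalar R}).

Definition lin_ext (V : lmodType R[i]) (F : I -> V) (a : cspace) : V :=
  \sum_i (a i : R[i]) *: F i.

(* C^I (x) K is modelled by the Hilbert sum of copies of K indexed by I; see
   [inner_tens], [tens_sum] and [tens_op_tens]. *)
Local Notation tensor := (hsum I K).

Definition tens (a : cspace) (x : K) : tensor :=
  ([ffun i => (a i : R[i]) *: x] : {ffun I -> K}).

Definition tens_op (A : cspace -> cspace) (B : K -> K) (f : tensor) : tensor :=
  \sum_i tens (A (cbasis i)) (B (f i)).

Lemma lin_ext_linear (V : lmodType R[i]) (F : I -> V) : linear (lin_ext F).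
Proof.
move=> c a b; rewrite /lin_ext scaler_sumr -big_split/=.
by apply: eq_bigr => i _; rewrite hsum_addE hsum_scaleE scalerDl scalerA.
Qed.

HB.instance Definition _ (V : lmodType R[i]) (F : I -> V) :=
  GRing.isLinear.Build R[i] cspace V *:%R (lin_ext F) (lin_ext_linear F).

Lemma lin_ext_cbasis (V : lmodType R[i]) (F : I -> V) i :
  lin_ext F (cbasis i) = F i.
Proof.
rewrite /lin_ext (bigD1 i)//= big1 => [|j ji].
  by rewrite hsumE eqxx scale1r addr0.
by rewrite hsumE (negbTE ji) scale0r.
Qed.

Lemma inner_cbasis i j : inner (cbasis i) (cbasis j) = (i == j)%:R :> R[i].
Proof.
rewrite /inner/= /hsum_inner (bigD1 i)//= big1 => [|k ki].
  by rewrite /inner/= /cinner !ffunE eqxx mul1r rmorph_nat addr0.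
by rewrite /inner/= /cinner !ffunE (negbTE ki) mul0r.
Qed.

Lemma cbasis_sum (a : cspace) : a = \sum_i (a i : R[i]) *: cbasis i.
Proof.
apply: hsumP => k; rewrite hsum_sumE (bigD1 k)//= big1 => [|j jk].
  by rewrite hsum_scaleE hsumE eqxx addr0 [RHS]mulr1.
by rewrite hsum_scaleE hsumE eq_sym (negbTE jk) scaler0.
Qed.

Lemma inner_tens a b x y :
  inner (tens a x) (tens b y) = inner a b * inner x y.
Proof.
rewrite /inner/= /hsum_inner mulr_suml; apply: eq_bigr => i _.
by rewrite !ffunE linearZl_LR linearZr_LR /= mulrA.
Qed.

Lemma tens_sum (f : tensor) : f = \sum_i tens (cbasis i) (f i).
Proof.
apply: hsumP => k; rewrite hsum_sumE (bigD1 k)//= big1 => [|j jk].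
  by rewrite !hsumE eqxx scale1r addr0.
by rewrite !hsumE eq_sym (negbTE jk) scale0r.
Qed.

Lemma tens_op_tens (A : {linear cspace -> cspace}) (B : {linear K -> K}) a x :
  tens_op A B (tens a x) = tens (A a) (B x).
Proof.
apply: hsumP => k; rewrite hsum_sumE hsumE {2}(cbasis_sum a).
rewrite linear_sum hsum_sumE scaler_suml; apply: eq_bigr => i _.
have AZ : A ((a i : R[i]) *: cbasis i) = (a i : R[i]) *: A (cbasis i).
  by rewrite linearZ.
have BZ : B ((a i : R[i]) *: x) = (a i : R[i]) *: B x by rewrite linearZ.
by rewrite !hsumE AZ BZ hsum_scaleE !scalerA mulrC.
Qed.

End Tensor.

Section BoundedTensor.
Variables (R : realType) (I : finType) (K : hilbertType R).

Lemma norm_tens (a : hsum I (cscalar R)) (x : K) :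
  `|tens a x| = `|a| * `|x|.
Proof.
by rewrite !norm_inner inner_tens sqrtCM ?nnegrE ?dot_ge0.
Qed.

Lemma bounded_tens_op
    (A : hsum I (cscalar R) -> hsum I (cscalar R)) (B : K -> K) :
  bounded_op B -> bounded_op (@tens_op R I K A B).
Proof.
move=> [M BM].
have [N NE] : exists N : R, \sum_i `|A (cbasis R i)| = N%:C%C.
  exists (complex.Re (\sum_i `|A (cbasis R i)|)).
  by rewrite RRe_real// ger0_real ?sumr_ge0.
exists (N * `|M|) => f; rewrite rmorphM/= -NE -mulrA mulr_suml.
apply: le_trans (ler_norm_sum _ _ _) _; apply: ler_sum => i _.
rewrite norm_tens ler_wpM2l//; apply: le_trans (BM _) _.
apply: (@le_trans _ _ (`|M|%:C%C * `|hsum_fun f i|)).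
  by rewrite ler_wpM2r// lecR ler_norm.
by rewrite ler_wpM2l ?lecR// le_norm_hsum.
Qed.

End BoundedTensor.

Lemma scale_comb (C : comPzRingType) (V : lmodType C) (p q c : C) (u v w z : V) :
  p *: (c *: u + v) + q *: (c *: w + z) =
  c *: (p *: u + q *: w) + (p *: v + q *: z).
Proof.
by rewrite !scalerDr !scalerA (mulrC p) (mulrC q) addrACA.
Qed.

Section QuantumWalk.
Variables (R : realType) (n : nat).

Definition Gamma := {set 'I_n.+1}.

Local Notation hspace := (hsum Gamma (cscalar R)).

Definition Zvec (sigma : Gamma) : hspace := cbasis R sigma.

Definition annih (j : 'I_n.+1) : hspace -> hspace :=
  lin_ext (fun sigma : Gamma => (j \in sigma)%:R *: Zvec (sigma :\ j)).

Definition creat (j : 'I_n.+1) : hspace -> hspace :=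
  lin_ext (fun sigma : Gamma => (1 - (j \in sigma)%:R) *: Zvec (j |: sigma)).

Lemma annihE j sigma :
  annih j (Zvec sigma) = (j \in sigma)%:R *: Zvec (sigma :\ j).
Proof. exact: lin_ext_cbasis. Qed.

Lemma creatE j sigma :
  creat j (Zvec sigma) = (1 - (j \in sigma)%:R) *: Zvec (j |: sigma).
Proof. exact: lin_ext_cbasis. Qed.

Definition magnetic_potential (nu : Gamma -> Gamma -> R) :=
  (forall sigma tau, - pi <= nu sigma tau <= pi) /\
  (forall sigma tau, nu sigma tau = - nu tau sigma).

Definition nu_at (nu : Gamma -> Gamma -> R) (j : 'I_n.+1) : R :=
  nu [set j]%SET ([set: 'I_n.+1] :\ j)%SET.

Definition expi (t : R) : R[i] := (cos t +i* sin t)%C.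

Definition Xi (nu : Gamma -> Gamma -> R) (j : 'I_n.+1) (a : hspace) : hspace :=
  expi (- nu_at nu j) *: creat j a + expi (nu_at nu j) *: annih j a.

Lemma Xi_linear nu j : linear (Xi nu j).
Proof.
move=> c a b; rewrite /Xi /creat /annih !lin_ext_linear.
exact: scale_comb.
Qed.

HB.instance Definition _ nu j :=
  GRing.isLinear.Build R[i] hspace hspace *:%R (Xi nu j) (Xi_linear nu j).

Variable K : hilbertType R.

Definition coin_system (C : 'I_n.+1 -> {linear K -> K}) :=
  [/\ forall j, bounded_op (C j),
      unitary (fun x => \sum_j C j x) &
      forall j k, j != k ->
        (forall x, adjoint (C j) (C k x) = 0) /\
        (forall x, C j (adjoint (C k) x) = 0)].

Definition Wop (nu : Gamma -> Gamma -> R) (C : 'I_n.+1 -> {linear K -> K})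
    (f : hsum Gamma K) : hsum Gamma K :=
  \sum_j tens_op (Xi nu j) (C j) f.

Lemma Wop_tens nu C (a : hspace) (x : K) :
  Wop nu C (tens a x) = \sum_j tens (Xi nu j a) (C j x).
Proof. by apply: eq_bigr => j _; rewrite tens_op_tens. Qed.

Definition Esign (sigma : Gamma) (j : 'I_n.+1) : R[i] :=
  2 * (j \in sigma)%:R - 1.

Definition Uop (C : 'I_n.+1 -> {linear K -> K}) (sigma : Gamma) (x : K) : K :=
  \sum_j Esign sigma j *: C j x.

End QuantumWalk.

(* Main.v *)
(** The operators [Xi nu j] have a joint eigenbasis: with
    [chi s t = \prod_(j in t) (E_s(j) e^(-i nu_j))], the vector
    [sum_t chi s t Z_t] is an eigenvector of every [Xi nu j], with eigenvalue
    [E_s(j)]. In this basis [Wop] is block diagonal with blocks [Uop C s], and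
    a finite direct sum is bounded below, after subtracting [l], if and only if
    every block is. *)
Require Import Defs.
From HB Require Import structures.
From mathcomp Require Import all_boot all_order all_algebra.
From mathcomp Require Import sesquilinear complex.
From mathcomp Require Import all_classical all_reals all_analysis.
From mathcomp Require Import ring.

Local Open Scope classical_set_scope.
Local Open Scope ring_scope.

Set Implicit Arguments.
Unset Strict Implicit.

Import Order.TTheory GRing.Theory Num.Theory.
Import numFieldNormedType.Exports.

(** If every constant fails, the counterexamples to the constants [k.+1], rescaled to norm 1, form a
    sequence of approximate eigenvectors. Conversely, a bound keeps the defect of unit vectors away
    from 0. *)
Lemma notAevP (R : realType) (H : hilbertType R) (T : H -> H) (l : R[i]) :
  (forall a x, T (a *: x) = a *: T x) ->
  ~ Aev T l <-> exists M : R[i], forall x, `|x| <= M * `|T x - l *: x|.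
Proof.
move=> TZ; split=> [lN|[M TM] [x [x1 xl]]].
  apply: contrapT => /forallNP hM; apply: lN.
  have /choice[y yP] (k : nat) : exists y : H, `|y| = 1 /\
      `|T y - l *: y| < k.+1%:R^-1.
    have /existsNP[x /negP] := hM k.+1%:R.
    rewrite -real_ltNge ?realM ?normr_real ?realn// => xT.
    have x0 : 0 < `|x| by apply: le_lt_trans xT; rewrite mulr_ge0.
    exists (`|x|^-1 *: x); rewrite normrZ normfV normr_id mulVf ?gt_eqF//.
    split=> //; rewrite TZ scalerA mulrC -scalerA -scalerBr normrZ.
    by rewrite normfV normr_id ltr_pdivrMl// ltr_pdivlMr ?ltr0n// mulrC.
  exists y; split=> [k|]; first by have [] := yP k.
  (* A positive element of [R[i]] has zero imaginary part, so [e] may be taken real. *)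
  apply/cvgrPdist_lt => e; case: e => e e' /[dup] e0.
  rewrite ltcE/= => /andP[/eqP ee]; rewrite ee in e0 *; move=> {}e0.
  have := near_infty_natSinv_lt (PosNum e0).
  apply: filterS => k /= ke; rewrite sub0r normrN normr_id.
  apply: lt_trans (yP k).2 _.
  by rewrite -(rmorph_nat (@real_complex R)) -fmorphV ltcR.
(* [M] is an arbitrary complex number; [|M| + 1] replaces it by a positive one. *)
have M0 : 0 < `|M| + 1 :> R[i] by rewrite ltr_wpDl.
move/cvgrPdist_lt : xl => /(_ (`|M| + 1)^-1); rewrite invr_gt0 => /(_ M0).
move=> [N _ /(_ N (leqnn N)) /=]; rewrite sub0r normrN normr_id.
rewrite -[(_ + _)^-1]mulr1 ltr_pdivlMl// => h.
have : 1 <= `|M| * `|T (x N) - l *: x N|.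
  have := TM (x N); rewrite x1 => h1.
  by rewrite -[X in _ * X]normr_id -normrM ger0_norm// (le_trans ler01).
apply/negP; rewrite -real_ltNge ?realM ?normr_real ?rpred1//.
by apply: le_lt_trans h; rewrite ler_wpM2r// lerDl.
Qed.

(** * Signs and phases *)

Lemma EsignK (R : realType) (n : nat) (s : Gamma n) j :
  Esign R s j * Esign R s j = 1.
Proof. by rewrite /Esign; case: (j \in s) => /=; ring. Qed.

Lemma expi_mulN (R : realType) (t : R) : expi t * expi (- t) = 1.
Proof.
rewrite /expi cosN sinN; apply/eqP; rewrite eq_complex/= -(cos2Dsin2 t).
by apply/andP; split; apply/eqP; ring.
Qed.

Lemma norm_expi (R : realType) (t : R) : `|expi t| = 1.
Proof. by rewrite /expi normc_def/= cos2Dsin2 sqrtr1. Qed.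

Lemma EsignV (R : realType) (n : nat) (s : Gamma n) j :
  (Esign R s j)^-1 = Esign R s j.
Proof. by apply: mulr1_eq; exact: EsignK. Qed.

Lemma expiV (R : realType) (t : R) : (expi t)^-1 = expi (- t).
Proof. by apply: mulr1_eq; exact: expi_mulN. Qed.

Lemma cspace_scaleE (R : realType) (I : finType) (c : R[i])
  (a : hsum I (cscalar R)) i : (c *: a) i = c * a i :> R[i].
Proof. by rewrite [LHS]hsum_scaleE. Qed.

(** * Linearity of elementary tensors *)

Section Tens.
Variables (R : realType) (I : finType) (K : hilbertType R).
Implicit Types (a b : hsum I (cscalar R)) (x y : K).

Lemma tensE a x i : tens a x i = (a i : R[i]) *: x.
Proof. exact: hsumE. Qed.

Lemma tensDl a b x : tens (a + b) x = tens a x + tens b x.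
Proof. by apply: hsumP => i; rewrite hsum_addE !tensE hsum_addE scalerDl. Qed.

Lemma tensZl (c : R[i]) a x : tens (c *: a) x = c *: tens a x.
Proof.
by apply: hsumP => i; rewrite [RHS]hsum_scaleE !tensE hsum_scaleE [RHS]scalerA.
Qed.

Lemma tens_linear a : linear (@tens R I K a).
Proof.
move=> c x y; apply: hsumP => i; rewrite hsum_addE hsum_scaleE !tensE.
by rewrite scalerDr !scalerA mulrC.
Qed.

HB.instance Definition _ a :=
  GRing.isLinear.Build R[i] K (hsum I K) *:%R (tens a) (tens_linear a).

End Tens.

(** * Joint eigenvectors of the operators [Xi nu j] *)

Section JointEigenvectors.
Variables (R : realType) (n : nat) (nu : Gamma n -> Gamma n -> R).
Implicit Types s t : Gamma n.

Definition chi s t : R[i] :=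
  \prod_(j in t) (Esign R s j * expi (- nu_at nu j)).

Lemma norm_chi s t : `|chi s t| = 1.
Proof.
rewrite normr_prod big1// => j _; rewrite normrM norm_expi mulr1.
apply/eqP; rewrite -sqrp_eq1// -normrX expr2 EsignK normr1 //.
Qed.

Lemma chi_neq0 s t : chi s t != 0.
Proof. by rewrite -normr_eq0 norm_chi oner_neq0. Qed.

Lemma chiU1 s t j : j \notin t ->
  chi s (j |: t) = Esign R s j * expi (- nu_at nu j) * chi s t.
Proof. by move=> jt; rewrite /chi big_setU1. Qed.

Lemma chiD1 s t j : j \in t ->
  chi s t = Esign R s j * expi (- nu_at nu j) * chi s (t :\ j).
Proof. by move=> jt; rewrite /chi (big_setD1 j). Qed.

(** Character orthogonality on the group of sign choices: the sum over [s] factors over [j], and a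
    [j] in exactly one of [t], [t'] contributes two opposite terms. *)
Lemma chi_ortho t t' :
  \sum_s chi s t / chi s t' = (t == t')%:R * #|Gamma n|%:R.
Proof.
have [->|tt'] := eqVneq t t'.
  rewrite mul1r (eq_bigr (fun=> 1)) ?sumr_const// => s _.
  by rewrite divff ?chi_neq0.
rewrite mul0r.
(* The factor at [j] of the quotient, where [b] tells whether [j] belongs to [s]. *)
pose F b j : R[i] :=
  (if j \in t then (2 * b%:R - 1) * expi (- nu_at nu j) else 1) /
  (if j \in t' then (2 * b%:R - 1) * expi (- nu_at nu j) else 1).
transitivity (\prod_j (F true j + F false j)).
  rewrite bigA_distr; apply: eq_bigr => s _.
  rewrite /chi [in LHS]big_mkcond [X in _ / X]big_mkcond -prodf_div.
  by apply: eq_bigr => j _; rewrite /F /Esign; case: (j \in s).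
have [j jP] : exists j, (j \in t) != (j \in t').
  apply/existsP; apply: contraR tt'; rewrite negb_exists => /forallP h.
  by apply/eqP/setP => j; apply/eqP; have := h j; rewrite negbK.
apply/eqP/prodf_eq0; exists j => //; apply/eqP; rewrite /F.
have -> : (2 * true%:R - 1 : R[i]) = 1 by rewrite mulr1 addrK.
have -> : (2 * false%:R - 1 : R[i]) = - 1 by rewrite mulr0 sub0r.
by case: (j \in t) (j \in t') jP => -[]// _;
  rewrite !mul1r !mulN1r ?invr1 ?mulr1 ?invrN subrr.
Qed.

Lemma creat_apply j a t :
  creat j a t = if j \in t then a (t :\ j) else 0 :> cscalar R.
Proof.
rewrite /creat /lin_ext hsum_sumE; case: ifPn => jt.
  rewrite (bigD1 (t :\ j))//= big1 => [|r rt].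
    rewrite !hsum_scaleE hsumE addr0 !inE eqxx/=.
    rewrite finset.setD1K// eqxx subr0 scale1r.
    exact: mulr1.
  (* Any other [r] gives 0: either it contains [j], or [t = j |: r] would force [r = t :\ j]. *)
  rewrite !hsum_scaleE hsumE; case: (boolP (j \in r)) => jr/=.
    by rewrite subrr scale0r scaler0.
  case: eqP => [tE|]; last by rewrite !scaler0.
  by move: rt; rewrite tE finset.setU1K ?eqxx.
rewrite big1// => r _; rewrite !hsum_scaleE hsumE.
case: eqP => [tE|]; last by rewrite !scaler0.
by move: jt; rewrite tE finset.setU11.
Qed.

Lemma annih_apply j a t :
  annih j a t = if j \in t then 0 else a (j |: t) :> cscalar R.
Proof.
rewrite /annih /lin_ext hsum_sumE; case: ifPn => jt.
  rewrite big1// => r _; rewrite !hsum_scaleE hsumE.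
  case: eqP => [tE|]; last by rewrite !scaler0.
  by move: jt; rewrite tE finset.setD11.
rewrite (bigD1 (j |: t))//= big1 => [|r rt].
  rewrite !hsum_scaleE hsumE addr0 finset.setU11 finset.setU1K// eqxx scale1r.
  exact: mulr1.
rewrite !hsum_scaleE hsumE; case: (boolP (j \in r)) => jr/=.
  case: eqP => [tE|]; last by rewrite !scaler0.
  by move: rt; rewrite tE finset.setD1K ?eqxx.
by rewrite scale0r scaler0.
Qed.

Definition eigenvec s : hsum (Gamma n) (cscalar R) :=
  ([ffun t => chi s t] : {ffun Gamma n -> cscalar R}).

Lemma eigenvecE s t : eigenvec s t = chi s t.
Proof. exact: hsumE. Qed.

Lemma Xi_apply j a t : Xi nu j a t =
  (if j \in t then expi (- nu_at nu j) * a (t :\ j)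
   else expi (nu_at nu j) * a (j |: t)) :> R[i].
Proof.
(* Coordinates lie in [cscalar R], a copy of [R[i]]; [congr2] brings both formulas to [R[i]], where
   exactly one of the two cases survives. *)
have := congr2
  (fun x y : R[i] => expi (- nu_at nu j) * x + expi (nu_at nu j) * y)
  (creat_apply j a t) (annih_apply j a t).
have -> : forall b (x y p q : R[i]),
    p * (if b then x else 0) + q * (if b then 0 else y) =
    if b then p * x else q * y.
  by case=> *; rewrite mulr0 ?addr0 ?add0r.
by move=> <-; rewrite /Xi hsum_addE; congr (_ + _); exact: cspace_scaleE.
Qed.

(** Toggling [j] in [t] changes [chi s t] by one factor; its phase matches or cancels that of [Xi],
    and the sign squares to 1. *)
Lemma Xi_eigenvec s j :
  Xi nu j (eigenvec s) = Esign R s j *: eigenvec s.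
Proof.
apply: hsumP => t; rewrite hsum_scaleE [LHS]Xi_apply !eigenvecE.
rewrite -[RHS]/(Esign R s j * chi s t); case: ifPn => jt.
  by rewrite (chiD1 _ jt) !mulrA EsignK mul1r.
by rewrite chiU1// -[_ * _ * chi s t]mulrA mulrCA [X in _ * X]mulrA expi_mulN mul1r.
Qed.

(** * Components along the joint eigenbasis *)

Variable K : hilbertType R.
Implicit Types f : hsum (Gamma n) K.

(* Up to the factor [#|Gamma n|], the component of [f] along [eigenvec s]. *)
Definition comp s f : K := \sum_t (chi s t)^-1 *: f t.

Lemma comp_linear s : linear (comp s).
Proof.
move=> c f g; rewrite /comp scaler_sumr -big_split/=; apply: eq_bigr => t _.
by rewrite hsum_addE hsum_scaleE scalerDr !scalerA mulrC.
Qed.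

HB.instance Definition _ s :=
  GRing.isLinear.Build R[i] (hsum (Gamma n) K) K *:%R (comp s) (comp_linear s).

Lemma norm_comp_le s f : `|comp s f| <= #|Gamma n|%:R * `|f|.
Proof.
apply: le_trans (ler_norm_sum _ _ _) _.
rewrite mulr_natl -sumr_const ler_sum// => t _.
by rewrite normrZ normfV norm_chi invr1 mul1r le_norm_hsum.
Qed.

(** Fourier inversion, by exchanging the sums and applying [chi_ortho]. *)
Lemma comp_inv f t :
  #|Gamma n|%:R *: f t = \sum_s chi s t *: comp s f.
Proof.
rewrite /comp; under eq_bigr do rewrite scaler_sumr.
rewrite exchange_big/=; under eq_bigr => r _.
  under eq_bigr do rewrite scalerA; rewrite -scaler_suml chi_ortho; over.
rewrite (bigD1 t)//= big1 => [|r rt]; first by rewrite eqxx mul1r addr0.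
by rewrite eq_sym (negbTE rt) mul0r scale0r.
Qed.

(** Inversion bounds each coordinate by the average of the component norms; summing over all [t]
    cancels the averaging factor. *)
Lemma norm_le_comp f : `|f| <= \sum_s `|comp s f|.
Proof.
have N0 : 0 < #|Gamma n|%:R :> R[i].
  by rewrite ltr0n; apply/card_gt0P; exists finset.set0.
apply: le_trans (norm_hsum_le _) _.
rewrite -(ler_pM2l N0) mulr_sumr.
apply: le_trans (_ : \sum_(t : Gamma n) \sum_s `|comp s f| <= _); last first.
  by rewrite sumr_const mulr_natl.
apply: ler_sum => t _.
rewrite -[X in X * _]ger0_norm ?ler0n// -normrZ.
rewrite [X in `|X|](comp_inv f t).
apply: le_trans (ler_norm_sum _ _ _) _; apply: ler_sum => s _.
by rewrite normrZ norm_chi mul1r.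
Qed.

Lemma comp_tens s a x : comp s (tens a x) = (\sum_t (chi s t)^-1 * a t) *: x.
Proof.
by rewrite /comp scaler_suml; apply: eq_bigr => t _; rewrite tensE scalerA.
Qed.

Lemma comp_Zvec s t x : comp s (tens (Zvec R t) x) = (chi s t)^-1 *: x.
Proof.
rewrite comp_tens (bigD1 t)//= big1 => [|r rt].
  by rewrite hsumE eqxx mulr1 addr0.
by rewrite hsumE (negbTE rt) mulr0.
Qed.

(** The dual of [Xi_eigenvec], stated on basis vectors because [tens_op] is defined through them. *)
Lemma comp_Xi s j t x :
  comp s (tens (Xi nu j (Zvec R t)) x) =
  (Esign R s j * (chi s t)^-1) *: x.
Proof.
have comb p q c d a b : comp s (tens (p *: (c *: a) + q *: (d *: b)) x) =
    (p * c) *: comp s (tens a x) + (q * d) *: comp s (tens b x).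
  by rewrite tensDl !tensZl linearD !linearZ/= !scalerA.
rewrite /Xi creatE annihE [LHS]comb (comp_Zvec _ (j |: t)).
rewrite (comp_Zvec _ (t :\ j)) !scalerA -scalerDl.
congr (_ *: _); case: (boolP (j \in t)) => jt.
  rewrite subrr mulr0 mul0r add0r mulr1 (chiD1 _ jt) !invfM EsignV expiV opprK.
  by rewrite !mulrA EsignK mul1r.
rewrite subr0 !mulr0 mul0r addr0 mulr1 chiU1// !invfM EsignV expiV opprK.
by rewrite mulrA [X in X * _]mulrCA [expi _ * _]mulrC expi_mulN mulr1.
Qed.

(** Block diagonality: [comp s] intertwines the walk with its block, since each [Xi nu j] acts on
    that component as the scalar [Esign R s j]. *)
Lemma comp_Wop (C : 'I_n.+1 -> {linear K -> K}) s f :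
  comp s (Wop nu C f) = Uop C s (comp s f).
Proof.
rewrite linear_sum; apply: eq_bigr => j _.
rewrite /tens_op linear_sum /comp linear_sum scaler_sumr -/comp.
apply: eq_bigr => t _; rewrite linearZ/= scalerA; exact: comp_Xi.
Qed.

End JointEigenvectors.

(** * Homogeneity, invariant copies of [K], and the two inclusions *)

Lemma WopZ (R : realType) (n : nat) (nu : Gamma n -> Gamma n -> R)
  (K : hilbertType R) (C : 'I_n.+1 -> {linear K -> K}) c f :
  Wop nu C (c *: f) = c *: Wop nu C f.
Proof.
rewrite /Wop scaler_sumr; apply: eq_bigr => j _.
rewrite /tens_op scaler_sumr; apply: eq_bigr => t _.
by rewrite hsum_scaleE !linearZ.
Qed.

Lemma UopZ (R : realType) (n : nat)
  (K : hilbertType R) (C : 'I_n.+1 -> {linear K -> K}) s c x :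
  Uop C s (c *: x) = c *: Uop C s x.
Proof.
rewrite /Uop scaler_sumr; apply: eq_bigr => j _.
by rewrite linearZ/= !scalerA mulrC.
Qed.

Lemma Wop_eigenvec (R : realType) (n : nat) (nu : Gamma n -> Gamma n -> R)
  (K : hilbertType R) (C : 'I_n.+1 -> {linear K -> K}) s x :
  Wop nu C (tens (eigenvec nu s) x) = tens (eigenvec nu s) (Uop C s x).
Proof.
rewrite Wop_tens linear_sum; apply: eq_bigr => j _.
by rewrite Xi_eigenvec tensZl linearZ.
Qed.

Lemma eigenvec_neq0 (R : realType) (n : nat) (nu : Gamma n -> Gamma n -> R) s :
  eigenvec nu s != 0.
Proof.
(* The coordinate at the empty set is already nonzero. *)
apply/eqP => /(congr1 (fun a => hsum_fun a finset.set0)) /eqP.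
by rewrite eigenvecE [X in _ == X]ffunE (negbTE (chi_neq0 _ _ _)).
Qed.

Theorem theorem4p6 (R : realType) (n : nat)
  (K : hilbertType R) (K_separable : separable K) (K_dim : dim_ge K n.+1)
  (nu : Gamma n -> Gamma n -> R) (nuP : magnetic_potential nu)
  (C : 'I_n.+1 -> {linear K -> K}) (CP : coin_system C) :
  Aev (Wop nu C) = \bigcup_(sigma : Gamma n) Aev (Uop C sigma).
Proof.
apply/seteqP; split=> l; apply: contraPP => /= lN.
  (* Both inclusions go by contraposition; here each block is bounded below, with its own
     constant. *)
  have /choice[M MP] s : exists M : R[i],
      forall x, `|x| <= M * `|Uop C s x - l *: x|.
    by apply/(notAevP _ (UopZ C s)) => ls; apply: lN; exists s.
  apply/(notAevP _ (WopZ nu C)).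
  (* The sum comes from [norm_le_comp], the cardinal from [norm_comp_le]. *)
  exists (\sum_s `|M s| * #|Gamma n|%:R) => f.
  apply: le_trans (norm_le_comp nu f) _; rewrite mulr_suml ler_sum// => s _.
  have := MP s (comp nu s f); rewrite -comp_Wop -linearZ -linearB/= => h.
  (* The right side of [h] dominates a norm, so it equals its own modulus, and [M s] can be replaced
     by its modulus. *)
  apply: le_trans (h) _; rewrite -[leLHS]ger0_norm ?(le_trans _ h)//.
  by rewrite normrM normr_id -mulrA ler_wpM2l// norm_comp_le.
move=> -[s _]; move: lN => /(notAevP _ (WopZ nu C))[M MP].
apply/(notAevP _ (UopZ C s)); exists M => x.
(* The bound for the walk is tested on [tens (eigenvec nu s) x]; the norm of the eigenvector
   cancels, so the same [M] serves the block. *)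
have a0 : 0 < `|eigenvec nu s| by rewrite normr_gt0 eigenvec_neq0.
rewrite -(ler_pM2l a0) -norm_tens (le_trans (MP _))//.
by rewrite Wop_eigenvec -linearZ -linearB/= norm_tens mulrCA.
Qed.
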